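(* $$\int_0^{\pi/2} e^{-\tan^2(x)}\,dx = \frac{e\pi}{2}\,\mathrm{erfc}(1).$$
   Context: The complementary error function is $\mathrm{erfc}(x)=\frac{2}{\sqrt{\pi}}\int_x^{\infty} e^{-t^2}\,dt$. *)

(* Defs.v *)
From HB Require Import structures.
From mathcomp Require Import all_boot all_order all_algebra.
From mathcomp Require Import all_classical all_reals all_analysis.

Set Implicit Arguments.
Unset Strict Implicit.
Unset Printing Implicit Defensive.

Import Order.TTheory GRing.Theory Num.Theory.
Import numFieldNormedType.Exports.

Local Open Scope classical_set_scope.
Local Open Scope ring_scope.

Definition erfc {R : realType} (x : R) : R :=
  2 / Num.sqrt pi *
  \int[@lebesgue_measure R]_(t in `[x, +oo[) expR (- t ^+ 2).

(* Main.v *)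
Require Import Defs.
From HB Require Import structures.
From mathcomp Require Import all_boot all_order all_algebra.
From mathcomp Require Import all_classical all_reals all_analysis.
From mathcomp Require Import measurable_realfun ring.

(* Substituting u = tan x turns the integral into that of
   e^(-u^2) / (1 + u^2) over [0, +oo[, that is, e times the integral over u of
   e^(-(1 + u^2)) / (1 + u^2) = \int_1^oo 2 t e^(-t^2 (1 + u^2)) dt.  By Tonelli
   the integral over u can be done first: it is Gaussian of scale t and gives
   sqrt(pi) e^(-t^2), whose integral over [1, +oo[ is (pi / 2) erfc 1. *)

Import Order.TTheory GRing.Theory Num.Theory.
Import numFieldNormedType.Exports.

Local Open Scope classical_set_scope.
Local Open Scope ring_scope.

(** Exhausts the domain by compact intervals that avoid the pole of [tan], so that monotone
    convergence applies. *)
Lemma bigcup_itv_atan (R : realType) :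
  \bigcup_n `[0, atan n%:R]%classic = `[0, pi / 2[%classic :> set R.
Proof.
apply/seteqP; split => x /=.
  move=> [n _]; rewrite /= !in_itv/= => /andP[-> /=].
  by move=> /le_lt_trans; apply; exact: atan_ltpi2.
rewrite in_itv/= => /andP[x0 xpi].
have [n tn] : exists n, tan x <= n%:R.
  exists (Num.bound `|tan x|); apply: le_trans (ler_norm _) _.
  exact/ltW/archi_boundP.
exists n => //=; rewrite in_itv/= x0/= -[leLHS]tanK ?le_atan//.
by rewrite in_itv/= xpi andbT (lt_le_trans _ x0)// oppr_lt0 divr_gt0// pi_gt0.
Qed.

(** The change of variable is x = [atan] u on each [0, n], where [f (tan x)] is continuous up to the
    image endpoint [atan n]. Nonnegativity of [f] then allows n to tend to infinity on both
    sides. *)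
Lemma ge0_integral_tan (R : realType) (f : R -> R) :
  continuous f -> (forall x, 0 <= f x) ->
  (\int[@lebesgue_measure R]_(x in `[0%R, (pi / 2)%R]) (f (tan x))%:E =
   \int[@lebesgue_measure R]_(x in `[0%R, +oo[) (f x / oneDsqr x)%:E)%E.
Proof.
move=> cf f0.
have cftan n : {within `[0, atan n%:R], continuous (fun x : R => f (tan x))}.
  apply: continuous_in_subspaceT => x; rewrite inE/= in_itv/= => /andP[x0 xn].
  apply: continuous_comp; last exact: cf.
  apply: continuous_tan; rewrite gt_eqF// cos_gt0_pihalf//.
  rewrite (le_lt_trans xn (atan_ltpi2 _)) andbT (lt_le_trans _ x0)//.
  by rewrite oppr_lt0 divr_gt0// pi_gt0.
have mftan n : measurable_fun `[0, atan n%:R] (fun x : R => f (tan x)).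
  apply: subspace_continuous_measurable_fun => //.
have cdatan : continuous (derive1 (@atan R)).
  move=> x; rewrite (_ : derive1 (@atan R) = (fun y => (oneDsqr y)^-1)).
    exact: continuous_oneDsqrV.
  by apply/funext => y; rewrite derive1_atan.
have subst n :
  (\int[@lebesgue_measure R]_(x in `[0%R, atan n%:R]) (f (tan x))%:E =
   \int[@lebesgue_measure R]_(x in `[0%R, n%:R]) (f x / oneDsqr x)%:E)%E.
  have := @integration_by_substitution_increasing R atan (fun x => f (tan x))
    0 n%:R.
  rewrite atan0 => ->//=.
  - by apply: eq_integral => x _; rewrite /GRing.mul/= atanK derive1_atan.
  - by move=> x y _ _; exact: lt_atan.
  - exact: cvgP (cvg_at_right_filter (cdatan _)).
  - exact: cvgP (cvg_at_left_filter (cdatan _)).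
  - split; first by move=> x _; exact: derivable_atan.
    + by apply: cvg_at_right_filter; exact: continuous_atan.
    + by apply: cvg_at_left_filter; exact: continuous_atan.
(* The union of the intervals misses pi / 2, so this null endpoint is dropped first. *)
rewrite -integral_itv_bndo_bndc -?bigcup_itv_atan; last first.
  by apply/measurable_EFinP/measurable_fun_bigcup.
have mEftan n := (measurable_EFinP _ _).2 (mftan n).
have tan_cvg : (\int[@lebesgue_measure R]_(x in `[0%R, atan n%:R])
    (f (tan x))%:E @[n --> \oo] -->
  \int[@lebesgue_measure R]_(x in \bigcup_n `[0%R, atan n%:R]%classic)
    (f (tan x))%:E)%E.
  apply: ge0_nondecreasing_set_cvg_integral => //.
  - move=> m n mn; apply/subsetPset => x /=; rewrite !in_itv/= => /andP[-> xm].
    by rewrite (le_trans xm)// le_atan// ler_nat.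
  - by move=> *; rewrite lee_fin.
(* By [subst], the sequence tending to the left side is also that of the integrals over [0, n],
   which tends to the right side. *)
rewrite -(cvg_lim _ tan_cvg)//; apply/cvg_lim => //.
rewrite (eq_cvg _ _ subst).
apply: ge0_cvgn_integral.
- by move=> x; rewrite divr_ge0.
- apply: continuous_measurable_fun => x.
  by apply: cvgM; [exact: cf|exact: continuous_oneDsqrV].
Qed.

(** Substitute y = a x in the half-line Gaussian integral. The Jacobian [a] stays in the integrand,
    where the factor t of the double integral will supply it. *)
Lemma integral_gauss_scale (R : realType) (a : R) : 0 < a ->
  (\int[@lebesgue_measure R]_(x in `[0%R, +oo[) (gauss_fun (a * x) * a)%:E =
   (Num.sqrt pi / 2)%:E)%E.
Proof.
move=> a0; rewrite -integral0y_gauss.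
have da : derive1 ( *%R a) = cst a.
  by apply/funext => x; rewrite derive1Ml// derive1_id mulr1.
have := (@increasing_ge0_integration_by_substitutiony R ( *%R a) gauss_fun 0).
rewrite mulr0 => ->//=.
- by apply: eq_integral => x _; rewrite da.
- by move=> x y _ _; rewrite ltr_pM2l.
- by rewrite da => x _; exact: cvg_cst.
- by rewrite da; exact: is_cvg_cst.
- by rewrite da; exact: is_cvg_cst.
- split => //; apply: cvg_at_right_filter.
  by apply: cvgM => //; exact: cvg_cst.
- exact: (gt0_cvgMry a0).
- by apply: continuous_subspaceT; exact: continuous_gauss_fun.
- by move=> x _; exact: gauss_fun_ge0.
Qed.

(** The antiderivative - e^(-t^2 c) / c vanishes at infinity. It serves with c = 1 + u^2 and a =
    1. *)
Lemma integral_gauss_tail (R : realType) (a c : R) : 0 < c -> 0 <= a ->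
  (\int[@lebesgue_measure R]_(t in `[a, +oo[)
     (2 * t * expR (- (t ^+ 2 * c)))%:E = (expR (- (a ^+ 2 * c)) / c)%:E)%E.
Proof.
move=> c0 a0.
have dF (t : R) : is_derive t 1 (fun t => - (expR (- (t ^+ 2 * c)) / c))
    (2 * t * expR (- (t ^+ 2 * c))).
  apply: is_derive_eq; rewrite /GRing.scale/=.
  by field; rewrite gt_eqF.
have cF : continuous (fun t : R => - (expR (- (t ^+ 2 * c)) / c)).
  move=> t; apply/differentiable_continuous/derivable1_diffP.
  by have [] := dF t.
rewrite (@ge0_continuous_FTC2y _ _ (fun t => - (expR (- (t ^+ 2 * c)) / c))
  _ 0).
- by rewrite sub0e -EFinN opprK.
- by move=> t at_; rewrite mulr_ge0 ?expR_ge0// mulr_ge0// (le_trans a0).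
- apply: continuous_subspaceT => t.
  by apply/differentiable_continuous/derivable1_diffP; exact: ex_derive.
- have cvg0 : expR (- (t ^+ 2 * c)) @[t --> +oo] --> (0 : R).
    apply: (cvg_comp (fun t => t ^+ 2 * c) (fun x => expR (- x))) => /=.
      by apply: gt0_cvgMly => //; exact: cvgr_expr2.
    exact: cvgr_expR.
  rewrite -oppr0 -(mul0r c^-1).
  by apply: cvgN; apply: cvgM => //; exact: cvg_cst.
- by move=> t _; have [] := dF t.
- by apply: cvg_at_right_filter; exact: cF.
- by move=> t _; rewrite derive1E; exact: derive_val.
Qed.

(** Tonelli on the whole product is applied to [f] extended by 0 outside the rectangle. Asking for
    nonnegativity only there matters: the kernel used below is negative for t < 0. *)
Lemma fubini_tonelli_setX {d1 d2} {T1 : measurableType d1}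
    {T2 : measurableType d2} {R : realType}
    {m1 : {sigma_finite_measure set T1 -> \bar R}}
    {m2 : {sigma_finite_measure set T2 -> \bar R}} {A : set T1} {B : set T2}
    (f : T1 * T2 -> \bar R) :
  measurable A -> measurable B -> measurable_fun (A `*` B) f ->
  (forall z, (A `*` B) z -> (0 <= f z)%E) ->
  (\int[m1]_(x in A) \int[m2]_(y in B) f (x, y) =
   \int[m2]_(y in B) \int[m1]_(x in A) f (x, y))%E.
Proof.
move=> mA mB mf f0.
have mAB := measurableX mA mB.
have tonelli := @fubini_tonelli _ _ _ _ _ m1 m2 (f \_ (A `*` B))
  ((measurable_restrictT f mAB).1 mf).
rewrite integral_mkcond [RHS]integral_mkcond.
have patchA x : ((fun x => \int[m2]_(y in B) f (x, y))%E \_ A) x =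
    (\int[m2]_y (f \_ (A `*` B)) (x, y))%E.
  rewrite patchE; case: ifPn => xA.
    rewrite integral_mkcond; apply: eq_integral => y _.
    by rewrite !patchE in_setX xA.
  by rewrite integral0_eq// => y _; rewrite patchE in_setX (negbTE xA).
have patchB y : ((fun y => \int[m1]_(x in A) f (x, y))%E \_ B) y =
    (\int[m1]_x (f \_ (A `*` B)) (x, y))%E.
  rewrite patchE; case: ifPn => yB.
    rewrite integral_mkcond; apply: eq_integral => x _.
    by rewrite !patchE in_setX yB andbT.
  by rewrite integral0_eq// => x _; rewrite patchE in_setX (negbTE yB) andbF.
under eq_integral do rewrite patchA.
under [RHS]eq_integral do rewrite patchB.
apply: tonelli => z; rewrite patchE; case: ifPn => // zAB; apply: f0.
by rewrite inE in zAB.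
Qed.

(* The integral on the left is the extended-real-valued Lebesgue integral of a
   nonnegative function, so the equation also asserts that it is finite.  [tan]
   is total, with [tan (pi / 2) = 0]; this affects the integrand only at one
   point. *)
Theorem theorem3p3 (R : realType) :
  (\int[@lebesgue_measure R]_(x in `[0%R, (pi / 2)%R])
     (expR (- tan x ^+ 2))%:E)%E
  = (expR 1 * pi / 2 * erfc 1)%:E.
Proof.
rewrite (@ge0_integral_tan R gauss_fun); last 2 first.
- exact: continuous_gauss_fun.
- exact: gauss_fun_ge0.
(* Here [z] stands for the pair (u, t). *)
pose k (z : R * R) := 2 * z.2 * expR (- (z.2 ^+ 2 * oneDsqr z.1)).
have mk : measurable_fun [set: R * R] k.
  apply: measurable_funM; first exact: measurable_funM.
  apply: measurableT_comp => //; apply: measurableT_comp => //.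
  apply: measurable_funM; first exact: measurable_funX.
  apply: measurableT_comp => //.
  by apply: continuous_measurable_fun; exact: continuous_oneDsqr.
have k0 (z : R * R) :
    (`[0, +oo[%classic `*` `[1, +oo[%classic) z -> (0 <= (k z)%:E)%E.
  case: z => x y [_] /=; rewrite in_itv/= andbT => y1.
  by rewrite lee_fin mulr_ge0 ?expR_ge0// mulr_ge0// (le_trans ler01).
have intk (u : R) :
  (\int[@lebesgue_measure R]_(t in `[1%R, +oo[) (k (u, t))%:E =
    (expR (- oneDsqr u) / oneDsqr u)%:E)%E.
  have u0 : 0 < oneDsqr u by [].
  have := @integral_gauss_tail R 1 _ u0 ler01.
  by rewrite expr1n mul1r => <-.
have mh : measurable_fun [set: R]
    (fun u : R => expR (- oneDsqr u) / oneDsqr u).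
  apply: continuous_measurable_fun => u.
  apply: cvgM; last exact: continuous_oneDsqrV.
  apply: continuous_comp; last exact: continuous_expR.
  by apply: cvgN; exact: continuous_oneDsqr.
transitivity ((expR 1)%:E * \int[@lebesgue_measure R]_(u in `[0%R, +oo[)
    (expR (- oneDsqr u) / oneDsqr u)%:E)%E.
  rewrite -ge0_integralZl//=; last first.
    exact/measurable_EFinP/measurable_funTS.
  apply: eq_integral => u _.
  rewrite -EFinM mulrA -expRD /gauss_fun /oneDsqr.
  by congr (expR _ / _)%:E; ring.
under eq_integral do rewrite -intk.
rewrite (fubini_tonelli_setX (m1 := @lebesgue_measure R)
  (m2 := @lebesgue_measure R) (EFin \o k))//=; last first.
  exact/measurable_EFinP/measurable_funTS.
(* [erfc] uses the real-valued integral; integrability of the Gaussian ensures that nothing is lost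
   in passing to it from the extended one. *)
have iE : (\int[@lebesgue_measure R]_(t in `[1%R, +oo[) (gauss_fun t)%:E =
    (\int[@lebesgue_measure R]_(t in `[1%R, +oo[) expR (- t ^+ 2))%:E)%E.
  rewrite fineK//; apply: integrable_fin_num => //=.
  exact: (integrableS _ _ _ integrableT_gauss).
transitivity ((expR 1)%:E * \int[@lebesgue_measure R]_(t in `[1%R, +oo[)
    ((Num.sqrt pi)%:E * (gauss_fun t)%:E))%E.
  congr (_ * _)%E; apply: eq_integral => t; rewrite inE/= in_itv/= andbT => t1.
  have t0 : 0 < t by exact: lt_le_trans t1.
  (* Since t^2 (1 + u^2) = t^2 + (t u)^2, the kernel splits into a factor free of u and a Gaussian
     of scale t. *)
  transitivity (\int[@lebesgue_measure R]_(u in `[0%R, +oo[)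
      ((2 * gauss_fun t)%:E * (gauss_fun (t * u) * t)%:E))%E.
    apply: eq_integral => u _; rewrite -EFinM; congr (_%:E).
    rewrite /k/= (_ : - _ = (- t ^+ 2) + (- (t * u) ^+ 2)); last first.
      by rewrite /oneDsqr; ring.
    by rewrite expRD /gauss_fun; ring.
  rewrite ge0_integralZl//=; last 3 first.
  - apply/measurable_EFinP/measurable_funTS/measurable_funM => //.
    apply: measurableT_comp; first exact: measurable_gauss_fun.
    exact: measurable_funM.
  - by move=> u _; rewrite lee_fin mulr_ge0 ?gauss_fun_ge0// ltW.
  - by rewrite lee_fin mulr_ge0 ?gauss_fun_ge0.
  by rewrite integral_gauss_scale// -!EFinM; congr _%:E; field.
rewrite ge0_integralZl//=; last 2 first.
- apply/measurable_EFinP; apply: measurable_funTS.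
  exact: measurable_gauss_fun.
- by move=> t _; rewrite lee_fin gauss_fun_ge0.
rewrite iE -!EFinM /erfc; congr (_%:E).
have sp : Num.sqrt pi != 0 :> R by rewrite gt_eqF// sqrtr_gt0 pi_gt0.
(* The [pi] outside the roots becomes the square of its root, which lets [field] cancel. *)
rewrite -{2}(@sqr_sqrtr R pi) ?pi_ge0//.
by field.
Qed.
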